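(* Let $(\mathbf x_k,\mathbf z_k,\boldsymbol\lambda_k)_{k\ge 0}$, $\boldsymbol\lambda_k=[\boldsymbol\alpha_k;\boldsymbol\beta_k]$, be generated by the DQM recursion (see context) with penalty constant $c$, and suppose the following hold. (1) Initialization: $\boldsymbol\alpha_0=-\boldsymbol\beta_0$, $\mathbf E_u\mathbf x_0=2\mathbf z_0$, and $\boldsymbol\alpha_0$ lies in the column space of $\mathbf E_o$. (2) Network: every singular value $\sigma(\mathbf E_u)$ of $\mathbf E_u$ satisfies $0<\gamma_u\le\sigma(\mathbf E_u)\le\Gamma_u$ for constants $\gamma_u,\Gamma_u$, and $\gamma_o>0$ is the smallest non-zero singular value of $\mathbf E_o$. (3) Each $f_i$ is twice differentiable and there are constants $0<m\le M<\infty$ with $m\mathbf I\preceq\nabla^2 f_i(\mathbf y)\preceq M\mathbf I$ for all $\mathbf y\in\mathbb R^p$ and all $i$. (4) There is a constant $L$ with $\|\nabla^2 f_i(\mathbf y)-\nabla^2 f_i(\hat{\mathbf y})\|\le L\|\mathbf y-\hat{\mathbf y}\|$ for all $\mathbf y,\hat{\mathbf y}\in\mathbb R^p$ and all $i$. Assume $c>4M^2/(m\gamma_u^2)$ and define $$\zeta_k:=\min\Big\{\tfrac{L}{2}\|\mathbf x_{k+1}-\mathbf x_k\|,\;2M\Big\}.$$ Let $\mu,\mu'>1$ be arbitrary constants and let $\eta_k\in\big(\zeta_k/m,\;c\gamma_u^2/\zeta_k\big)$ be arbitrary (the right endpoint being $+\infty$ when $\zeta_k=0$). Then for all $k\ge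 0$ $$\|\mathbf u_{k+1}-\mathbf u^*\|_{\mathbf C}^2\le\frac{1}{1+\delta_k}\,\|\mathbf u_k-\mathbf u^*\|_{\mathbf C}^2,$$ where the positive scalars $\delta_k$ are given by $$\delta_k=\min\left\{\frac{(\mu-1)(c\gamma_u^2-\eta_k\zeta_k)\gamma_o^2}{\mu\mu'\left(c\,\Gamma_u^2\gamma_u^2+\frac{4\zeta_k^2}{c(\mu'-1)}\right)},\;\frac{m-\zeta_k/\eta_k}{\frac{c\,\Gamma_u^2}{4}+\frac{\mu M^2}{c\gamma_o^2}}\right\}.$$
   Context: Network and matrices. Consider a connected network with node set $\mathcal V=\{1,\dots,n\}$ and a set $\mathcal E$ of $r$ ordered edges $(i,j)$, symmetric in the sense that $(i,j)\in\mathcal E$ iff $(j,i)\in\mathcal E$. The block source matrix $\mathbf A_s\in\mathbb R^{rp\times np}$ consists of $r\times n$ blocks of size $p\times p$, indexed by edges $e$ and nodes $i$: $(\mathbf A_s)_{e,i}=\mathbf I_p$ if $e=(i,j)\in\mathcal E$ for some $j$, and $\mathbf 0$ otherwise. The block destination matrix $\mathbf A_d\in\mathbb R^{rp\times np}$ has $(\mathbf A_d)_{e,i}=\mathbf I_p$ if $e=(j,i)\in\mathcal E$ for some $j$, and $\mathbf 0$ otherwise. Set $\mathbf A=[\mathbf A_s;\mathbf A_d]\in\mathbb R^{2rp\times np}$ and $\mathbf B=[-\mathbf I_{rp};-\mathbf I_{rp}]\in\mathbb R^{2rp\times rp}$ (semicolons denote vertical stacking), $\mathbf E_o=\mathbf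 A_s-\mathbf A_d$ (oriented incidence matrix), $\mathbf E_u=\mathbf A_s+\mathbf A_d$ (unoriented incidence matrix). Objective. $f_i:\mathbb R^p\to\mathbb R$ are the local costs; for $\mathbf x=[\mathbf x_1;\dots;\mathbf x_n]\in\mathbb R^{np}$, $f(\mathbf x)=\sum_{i=1}^n f_i(\mathbf x_i)$. The problem is $\min_{\mathbf x,\mathbf z} f(\mathbf x)$ subject to $\mathbf A\mathbf x+\mathbf B\mathbf z=\mathbf 0$, with $\mathbf z\in\mathbb R^{rp}$; $(\mathbf x^*,\mathbf z^* )$ denotes its unique solution. $\boldsymbol\alpha^*$ denotes the unique vector in the column space of $\mathbf E_o$ such that $\boldsymbol\lambda^*=[\boldsymbol\alpha^*;-\boldsymbol\alpha^*]$ is an optimal Lagrange multiplier, i.e. $\nabla f(\mathbf x^* )+\mathbf A^T\boldsymbol\lambda^*=\mathbf 0$ (such a vector exists and is unique). DQM recursion with constant $c>0$: with $\mathbf H_k=\nabla^2 f(\mathbf x_k)$ and $\boldsymbol\lambda_k=[\boldsymbol\alpha_k;\boldsymbol\beta_k]$, $\boldsymbol\alpha_k,\boldsymbol\beta_k\in\mathbb R^{rp}$, for all $k\ge 0$ the iterates $\mathbf x_{k+1},\mathbf z_{k+1},\boldsymbol\lambda_{k+1}$ are determined by $$\nabla f(\mathbf x_k)+\mathbf H_k(\mathbf x_{k+1}-\mathbf x_k)+\mathbf A^T\boldsymbol\lambda_k+c\mathbf A^T(\mathbf A\mathbf x_{k+1}+\mathbf B\mathbf z_k)=\mathbf 0,$$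 $$\mathbf B^T\boldsymbol\lambda_k+c\mathbf B^T(\mathbf A\mathbf x_{k+1}+\mathbf B\mathbf z_{k+1})=\mathbf 0,\qquad \boldsymbol\lambda_{k+1}-\boldsymbol\lambda_k-c(\mathbf A\mathbf x_{k+1}+\mathbf B\mathbf z_{k+1})=\mathbf 0.$$ Energy. $\mathbf u_k=[\mathbf z_k;\boldsymbol\alpha_k]$, $\mathbf u^*=[\mathbf z^*;\boldsymbol\alpha^*]$, $\mathbf C=\mathrm{diag}(c\mathbf I_{rp},(1/c)\mathbf I_{rp})$, and $\|\mathbf a\|_{\mathbf C}^2=\mathbf a^T\mathbf C\mathbf a$, so $\|\mathbf u_k-\mathbf u^*\|_{\mathbf C}^2=c\|\mathbf z_k-\mathbf z^*\|^2+\frac1c\|\boldsymbol\alpha_k-\boldsymbol\alpha^*\|^2$. Norms are Euclidean for vectors and spectral for matrices. *)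

(* Defs.v *)
From HB Require Import structures.
From mathcomp Require Import all_boot all_order all_algebra.
From mathcomp Require Import all_classical all_reals all_analysis.

Set Implicit Arguments.
Unset Strict Implicit.
Unset Printing Implicit Defensive.

Import Order.TTheory GRing.Theory Num.Theory.
Import numFieldNormedType.Exports.

Local Open Scope classical_set_scope.
Local Open Scope ring_scope.

Section LinearAlgebra.
Variable R : realType.

Definition quad N (A : 'M[R]_N) (v : 'cV[R]_N) : R := (v^T *m A *m v) 0 0.

(* The library norm `|v| on matrices is the max norm (it serves only to define
   the topology, hence differentiability). *)
Definition enorm N (v : 'cV[R]_N) : R := Num.sqrt (\sum_i v i 0 ^+ 2).

Definition spectral_norm N P (A : 'M[R]_(N, P)) : R :=
  sup [set enorm (A *m v) | v in [set v : 'cV[R]_P | enorm v <= 1]].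

Definition singular_value N P (A : 'M[R]_(N, P)) (s : R) : Prop :=
  0 <= s /\ eigenvalue (A^T *m A) (s ^+ 2).

Definition psd N (A : 'M[R]_N) : Prop :=
  A^T = A /\ forall v, 0 <= quad A v.

Definition loewner_le N (A B : 'M[R]_N) : Prop := psd (B - A).

Definition in_colspace N P (A : 'M[R]_(N, P)) (v : 'cV[R]_N) : Prop :=
  exists w, v = A *m w.

End LinearAlgebra.

Section Calculus.
Variables (R : realType) (N : nat).
Implicit Types (f : 'cV[R]_N -> R) (x : 'cV[R]_N).

Definition grad f x : 'cV[R]_N := \col_i 'D_(delta_mx i 0) f x.

Definition hess f x : 'M[R]_N :=
  \matrix_(i, j) 'D_(delta_mx j 0) (fun y => grad f y i 0) x.

Definition twice_differentiable f : Prop :=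
  (forall x, differentiable f x) /\ (forall x, differentiable (grad f) x).

End Calculus.

Section Network.
Variables (R : realType) (n p : nat) (E : {set 'I_n * 'I_n}).

Definition symmetric_edges : Prop :=
  forall i j, ((i, j) \in E) = ((j, i) \in E).

Definition connected_network : Prop :=
  forall i j, connect [rel u v | (u, v) \in E] i j.

(* r = #|E|; the edge with index e : 'I_#|E| is the ordered pair enum_val e.
   Stacked vectors of R^(np) and R^(rp) have a sum of block sizes as dimension,
   so that the block matrix operations of the library apply. *)
Definition nodevec := 'cV[R]_(\sum_(i < n) p).
Definition edgevec := 'cV[R]_(\sum_(e < #|E|) p).

Definition source_mx : 'M[R]_(\sum_(e < #|E|) p, \sum_(i < n) p) :=
  \mxblock_(e < #|E|, i < n)
    (if (enum_val e).1 == i then 1%:M else 0 : 'M[R]_p).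

Definition dest_mx : 'M[R]_(\sum_(e < #|E|) p, \sum_(i < n) p) :=
  \mxblock_(e < #|E|, i < n)
    (if (enum_val e).2 == i then 1%:M else 0 : 'M[R]_p).

Definition constrA := col_mx source_mx dest_mx.

Definition constrB :
    'M[R]_(\sum_(e < #|E|) p + \sum_(e < #|E|) p, \sum_(e < #|E|) p) :=
  col_mx (- 1%:M) (- 1%:M).

Definition oriented_inc := source_mx - dest_mx.
Definition unoriented_inc := source_mx + dest_mx.

Definition total_cost (fi : 'I_n -> 'cV[R]_p -> R) (x : nodevec) : R :=
  \sum_(i < n) fi i (submxcol x i).

Definition is_solution (f : nodevec -> R) (x : nodevec) (z : edgevec) : Prop :=
  constrA *m x + constrB *m z = 0 /\
  forall x' z', constrA *m x' + constrB *m z' = 0 -> f x <= f x'.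

Definition dqm_recursion (f : nodevec -> R) (c : R)
    (x : nat -> nodevec) (z alpha beta : nat -> edgevec) : Prop :=
  let lambda k := col_mx (alpha k) (beta k) in
  forall k,
  [/\ grad f (x k) + hess f (x k) *m (x k.+1 - x k)
        + constrA^T *m lambda k
        + c *: (constrA^T *m (constrA *m x k.+1 + constrB *m z k)) = 0,
      constrB^T *m lambda k
        + c *: (constrB^T *m (constrA *m x k.+1 + constrB *m z k.+1)) = 0
    & lambda k.+1 - lambda k
        - c *: (constrA *m x k.+1 + constrB *m z k.+1) = 0].

Definition energy_mx (c : R) :
    'M[R]_(\sum_(e < #|E|) p + \sum_(e < #|E|) p) :=
  block_mx c%:M 0 0 (c^-1)%:M.

End Network.

(* Main.v *)
(* Eliminating beta and z (beta_k = - alpha_k and E_u x_k = 2 z_k along the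
   iteration) turns the recursion into the perturbed optimality system
     (grad f(x_{k+1}) - grad f(xs)) + e_k + E_o^T (alpha_{k+1} - alphas)
       + c E_u^T (z_{k+1} - z_k) = 0,
   where e_k is the error of the quadratic model, |e_k| <= zeta_k |x_{k+1} - x_k|.
   Pairing it with x_{k+1} - xs and using strong convexity bounds the energy drop
   from below by a combination of |x_{k+1} - xs|^2 and |z_{k+1} - z_k|^2; solving
   it for E_o^T (alpha_{k+1} - alphas), which controls alpha_{k+1} - alphas on the
   column space of E_o, bounds the new energy from above by the same two
   quantities.  The rate delta_k is the smaller ratio of their coefficients. *)
Require Import Defs.
From HB Require Import structures.
From mathcomp Require Import all_boot all_order all_algebra.
From mathcomp Require Import all_classical all_reals all_analysis.
From mathcomp Require Import ring lra.
Set Implicit Arguments.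
Unset Strict Implicit.
Unset Printing Implicit Defensive.
Import Order.TTheory GRing.Theory Num.Theory.
Import numFieldNormedType.Exports.
Local Open Scope ring_scope.

(** * Euclidean inner product, norm inequalities, spectral norm *)

Section Dot.
Variable R : realType.

Definition dot N (u v : 'cV[R]_N) : R := (u^T *m v) 0 0.

Lemma dotE N (u v : 'cV[R]_N) : dot u v = \sum_i u i 0 * v i 0.
Proof. by rewrite /dot mxE; apply: eq_bigr => i _; rewrite mxE. Qed.

Lemma dotC N (u v : 'cV[R]_N) : dot u v = dot v u.
Proof. by rewrite !dotE; apply: eq_bigr => i _; rewrite mulrC. Qed.

Lemma dotDr N (u v w : 'cV[R]_N) : dot u (v + w) = dot u v + dot u w.
Proof. by rewrite /dot mulmxDr mxE. Qed.

Lemma dotNr N (u v : 'cV[R]_N) : dot u (- v) = - dot u v.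
Proof. by rewrite /dot mulmxN mxE. Qed.

Lemma dotBr N (u v w : 'cV[R]_N) : dot u (v - w) = dot u v - dot u w.
Proof. by rewrite dotDr dotNr. Qed.

Lemma dotZr N (a : R) (u v : 'cV[R]_N) : dot u (a *: v) = a * dot u v.
Proof. by rewrite /dot -scalemxAr mxE. Qed.

Lemma dotDl N (u v w : 'cV[R]_N) : dot (u + v) w = dot u w + dot v w.
Proof. by rewrite dotC dotDr !(dotC w). Qed.

Lemma dotNl N (u v : 'cV[R]_N) : dot (- u) v = - dot u v.
Proof. by rewrite dotC dotNr dotC. Qed.

Lemma dotZl N (a : R) (u v : 'cV[R]_N) : dot (a *: u) v = a * dot u v.
Proof. by rewrite dotC dotZr dotC. Qed.

Definition dot_lin := (dotDr, dotNr, dotZr, dotDl, dotNl, dotZl).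

Lemma dot0r N (u : 'cV[R]_N) : dot u 0 = 0.
Proof. by rewrite /dot mulmx0 mxE. Qed.

Lemma dot_mulmx N P (A : 'M[R]_(N, P)) u v : dot u (A *m v) = dot (A^T *m u) v.
Proof. by rewrite /dot trmx_mul trmxK mulmxA. Qed.

Lemma dot_ge0 N (u : 'cV[R]_N) : 0 <= dot u u.
Proof. by rewrite dotE sumr_ge0// => i _; rewrite -expr2 sqr_ge0. Qed.

Lemma dot_eq0 N (u : 'cV[R]_N) : (dot u u == 0) = (u == 0).
Proof.
apply/idP/eqP => [|->]; last by rewrite dot0r.
rewrite dotE psumr_eq0 => [/allP u0|i _]; last by rewrite -expr2 sqr_ge0.
apply/colP => i; rewrite mxE; apply/eqP.
by have := u0 i; rewrite mem_index_enum mulf_eq0 orbb => /(_ isT).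
Qed.

Lemma dot_gt0 N (u : 'cV[R]_N) : u != 0 -> 0 < dot u u.
Proof. by rewrite -dot_eq0 lt0r dot_ge0 andbT. Qed.

Lemma quadE N (A : 'M[R]_N) v : quad A v = dot v (A *m v).
Proof. by rewrite /quad /dot mulmxA. Qed.

Lemma enorm_ge0 N (v : 'cV[R]_N) : 0 <= enorm v.
Proof. exact: sqrtr_ge0. Qed.

Lemma enorm_sqr N (v : 'cV[R]_N) : enorm v ^+ 2 = dot v v.
Proof.
rewrite sqr_sqrtr; last by rewrite sumr_ge0// => i _; rewrite sqr_ge0.
by rewrite dotE; apply: eq_bigr => i _; rewrite expr2.
Qed.

Lemma enormE N (v : 'cV[R]_N) : enorm v = Num.sqrt (dot v v).
Proof. by rewrite -enorm_sqr sqrtr_sqr ger0_norm ?enorm_ge0. Qed.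

Lemma enormZ N a (v : 'cV[R]_N) : enorm (a *: v) = `|a| * enorm v.
Proof.
by rewrite !enormE dotZr dotZl mulrA -expr2 sqrtrM ?sqr_ge0// sqrtr_sqr.
Qed.

(** Evaluating the quadratic at its minimiser [b / d] gives the discriminant inequality. *)
Lemma discr_le (a b d : R) : 0 <= d ->
  (forall s, 0 <= a - 2 * s * b + s ^+ 2 * d) -> b ^+ 2 <= a * d.
Proof.
move=> dge0 h; have [d0|d0] := ltrP 0 d.
  have := h (b / d).
  rewrite (_ : _ + _ = (a * d - b ^+ 2) / d); last by field; rewrite gt_eqF.
  by rewrite pmulr_lge0 ?invr_gt0// subr_ge0.
have dE : d = 0 by apply/eqP; rewrite eq_le d0.
rewrite {}dE in h *; rewrite mulr0.
have [->|b0] := eqVneq b 0; first by rewrite expr0n.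
(* With [d = 0] the polynomial is affine, and here it would equal -1. *)
have := h ((a + 1) / (2 * b)).
rewrite mulr0 (_ : 2 * _ * b = a + 1); last by field.
by lra.
Qed.

(** [quad A (u - s *: v)] is a nonnegative quadratic in [s]. Besides the identity matrix, [A] will
    be a Hessian. *)
Lemma psd_cauchy_schwarz N (A : 'M[R]_N) u v : psd A ->
  dot u (A *m v) ^+ 2 <= dot u (A *m u) * dot v (A *m v).
Proof.
move=> [AT A0]; apply: discr_le => [|s]; first by rewrite -quadE.
have := A0 (u - s *: v); rewrite quadE mulmxBr -scalemxAr !dot_lin.
rewrite (_ : dot v (A *m u) = dot u (A *m v)); last by rewrite dotC dot_mulmx AT.
by congr (_ <= _); ring.
Qed.

Lemma psd1 N : psd (1%:M : 'M[R]_N).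
Proof. by split=> [|v]; rewrite ?tr_scalar_mx// quadE mul1mx dot_ge0. Qed.

Lemma cauchy_schwarz N (u v : 'cV[R]_N) : dot u v ^+ 2 <= dot u u * dot v v.
Proof. by have := psd_cauchy_schwarz u v (psd1 N); rewrite !mul1mx. Qed.

Lemma dot_le_enorm N (u v : 'cV[R]_N) : dot u v <= enorm u * enorm v.
Proof.
have [|/ltW d0] := lerP (dot u v) 0.
  by move=> /le_trans; apply; rewrite mulr_ge0 ?enorm_ge0.
rewrite -(ler_pXn2r (n := 2)) ?nnegrE ?mulr_ge0 ?enorm_ge0//.
by rewrite exprMn !enorm_sqr cauchy_schwarz.
Qed.

(** Duality, tested at [w = v]. It reduces vector bounds to scalar pairings, to which the mean value
    theorem applies. *)
Lemma enorm_le_dot N (v : 'cV[R]_N) (a : R) : 0 <= a ->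
  (forall w, dot w v <= a * enorm w) -> enorm v <= a.
Proof.
move=> a0 /(_ v); rewrite -enorm_sqr expr2.
have [->//|v0] := eqVneq (enorm v) 0.
by rewrite ler_pM2r// lt0r v0 enorm_ge0.
Qed.

Lemma enormD N (u v : 'cV[R]_N) : enorm (u + v) <= enorm u + enorm v.
Proof.
apply: enorm_le_dot => [|w]; first by rewrite addr_ge0 ?enorm_ge0.
by rewrite dotDr mulrDl !(mulrC _ (enorm w)) lerD ?dot_le_enorm.
Qed.

Lemma enormN N (v : 'cV[R]_N) : enorm (- v) = enorm v.
Proof. by rewrite !enormE dotNr dotNl opprK. Qed.

Lemma enorm_le_dotM N P (v : 'cV[R]_N) (w : 'cV[R]_P) (a : R) : 0 <= a ->
  dot v v <= a ^+ 2 * dot w w -> enorm v <= a * enorm w.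
Proof.
move=> a0 h; rewrite -(ler_pXn2r (n := 2)) ?nnegrE ?mulr_ge0 ?enorm_ge0//.
by rewrite exprMn !enorm_sqr.
Qed.

Lemma dot_le_enormM N P (v : 'cV[R]_N) (w : 'cV[R]_P) (a : R) :
  enorm v <= a * enorm w -> dot v v <= a ^+ 2 * dot w w.
Proof.
move=> h; rewrite -!enorm_sqr -exprMn.
by rewrite ler_pXn2r ?nnegrE ?enorm_ge0// (le_trans (enorm_ge0 v)).
Qed.

(** The gap between the two sides is [|(k - 1) u - v|^2 / (k - 1)]. The free weight [k] will be [mu]
    or [mu']. *)
Lemma dotDD_le N (u v : 'cV[R]_N) (k : R) : 1 < k ->
  dot (u + v) (u + v) <= k * dot u u + k / (k - 1) * dot v v.
Proof.
move=> k1; have k0 : 0 < k - 1 by rewrite subr_gt0.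
have := dot_ge0 ((k - 1) *: u - v); rewrite !dot_lin (dotC v u) => h.
rewrite -subr_ge0 [leRHS](_ : _ = (k - 1)^-1 *
  ((k - 1) * ((k - 1) * dot u u - dot u v) - ((k - 1) * dot u v - dot v v))).
  apply: mulr_ge0; first by rewrite invr_ge0 ltW.
  by move: h; congr (_ <= _); ring.
by field; exact: lt0r_neq0.
Qed.

(** With [t = |A^T w|^2 = <A A^T w, w>], Cauchy-Schwarz and the bound on [A] give
    [t^2 <= a t |w|^2], and a positive [t] cancels. *)
Lemma dot_trmx_le N P (A : 'M[R]_(N, P)) (a : R) : 0 <= a ->
  (forall v, dot (A *m v) (A *m v) <= a * dot v v) ->
  forall w, dot (A^T *m w) (A^T *m w) <= a * dot w w.
Proof.
move=> a0 h w; set t := dot _ _.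
have [t0|t0] := leP t 0; first by rewrite (le_trans t0)// mulr_ge0 ?dot_ge0.
rewrite -(ler_pM2r t0) -expr2 {1}/t dot_mulmx trmxK dotC.
rewrite (le_trans (cauchy_schwarz _ _))// mulrAC mulrC.
by rewrite ler_wpM2r ?dot_ge0// mulrC.
Qed.

(** The supremum is informative only for a bounded set; the Frobenius norm is a bound, by
    Cauchy-Schwarz on each row. *)
Lemma spectral_norm_has_ubound N P (A : 'M[R]_(N, P)) :
  has_ubound [set enorm (A *m v) | v in [set v : 'cV[R]_P | enorm v <= 1]]%classic.
Proof.
exists (Num.sqrt (\sum_i dot (row i A)^T (row i A)^T)) => _ [v v1 <-].
rewrite enormE ler_wsqrtr// dotE ler_sum// => i _.
have -> : (A *m v) i 0 = dot (row i A)^T v by rewrite /dot trmxK -row_mul [RHS]mxE.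
rewrite -expr2 (le_trans (cauchy_schwarz _ _))// ler_piMr ?dot_ge0//.
by rewrite -enorm_sqr exprn_ile1 ?enorm_ge0.
Qed.

Lemma spectral_norm_ge0 N P (A : 'M[R]_(N, P)) : 0 <= spectral_norm A.
Proof.
apply: sup_upper_bound; first last.
  by exists 0; rewrite ?mulmx0/= /enorm big1 ?sqrtr0//= => i _; rewrite mxE expr0n.
split; last exact: spectral_norm_has_ubound.
by exists (enorm (A *m 0)), 0 => //=; rewrite /enorm big1 ?sqrtr0// => i _; rewrite mxE expr0n.
Qed.

Lemma spectral_norm_le N P (A : 'M[R]_(N, P)) v :
  enorm (A *m v) <= spectral_norm A * enorm v.
Proof.
have [->|v0] := eqVneq v 0.
  by rewrite mulmx0 !enormE !dot0r sqrtr0 mulr0.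
have nv : 0 < enorm v by rewrite enormE sqrtr_gt0 dot_gt0.
rewrite -ler_pdivrMr// mulrC -[X in X * _](@gtr0_norm _ (enorm v)^-1) ?invr_gt0//.
rewrite -enormZ scalemxAr; apply: sup_ubound; first exact: spectral_norm_has_ubound.
by exists ((enorm v)^-1 *: v) => //=; rewrite enormZ gtr0_norm ?invr_gt0// mulVf ?gt_eqF.
Qed.

End Dot.

(** * Extremal eigenvalues by compactness *)

Section Rayleigh.
Variable R : realType.

Lemma continuous_quad_form N (T : 'M[R]_N) :
  continuous (fun u : 'rV[R]_N => (u *m T *m u^T) 0 0).
Proof.
rewrite (_ : (fun _ => _) =
    fun u : 'rV[R]_N => \sum_j (\sum_i u 0 i * T i j) * u 0 j); last first.
  by apply/funext => v; rewrite mxE; apply: eq_bigr => j _; rewrite !mxE.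
have coordM (k : R) i : continuous (fun u : 'rV[R]_N => u 0 i * k).
  by move=> v; apply: continuousM; [exact: coord_continuous|exact: cst_continuous].
apply: continuous_big => [|j _ v]; first exact: add_continuous.
apply: continuousM; last exact: coord_continuous.
by apply: continuous_big => [|i _]; [exact: add_continuous|exact: coordM].
Qed.

(* The minimum of the Rayleigh quotient of a symmetric matrix over an invariant
   subspace, attained by compactness of the unit sphere, is an eigenvalue. *)
Lemma rayleigh_ge N P (S : 'M[R]_N) (K : 'M[R]_(P, N)) (l : R) :
  S^T = S ->
  (forall v : 'cV_N, K *m v = 0 -> K *m (S *m v) = 0) ->
  (forall a (v : 'cV_N), K *m v = 0 -> v != 0 -> S *m v = a *: v -> l <= a) ->
  forall w : 'cV_N, K *m w = 0 -> l * dot w w <= dot w (S *m w).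
Proof.
move=> ST KS hl w Kw.
have [->|w0] := eqVneq w 0; first by rewrite mulmx0 !dot0r mulr0.
pose q T (u : 'rV[R]_N) := (u *m T *m u^T) 0 0.
have qE T u : q T u = dot u^T (T *m u^T) by rewrite /q /dot trmxK mulmxA.
(* Reading [K *m v = 0] as [|K v|^2 = 0] makes both constraints level sets of continuous quadratic
   forms, hence closed. *)
pose A := ([set u | q (K^T *m K) u = 0] `&` [set u | q 1%:M u = 1])%classic.
have AP (v : 'cV[R]_N) : A v^T <-> K *m v = 0 /\ dot v v = 1.
  rewrite /A /= !qE mul1mx trmxK -mulmxA dot_mulmx trmxK.
  split=> -[h1 h2]; split=> //; last by rewrite h1 dot0r.
  by apply/eqP; rewrite -dot_eq0 h1.
have normalA (v : 'cV[R]_N) : v != 0 -> K *m v = 0 -> A ((enorm v)^-1 *: v)^T.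
  move=> v0 Kv; apply/AP; split; first by rewrite -scalemxAr Kv scaler0.
  have nv : enorm v != 0 by rewrite -sqrf_eq0 enorm_sqr dot_eq0.
  by rewrite !dot_lin -enorm_sqr; field.
have A0 : (A !=set0)%classic by exists ((enorm w)^-1 *: w)^T; exact: normalA.
have clA : closed A.
  have clq T a : closed (q T @^-1` [set x | x = a])%classic.
    apply: preimage_closed; last exact: closed_eq.
    by move=> u _; exact: continuous_quad_form.
  by apply: closedI; exact: clq.
(* Boundedness refers to the max norm: each entry of a Euclidean unit vector is at most 1 in
   absolute value. *)
have bdA : bounded_set A.
  exists 1; split=> // r r1 u [_ /= u1].
  rewrite (le_trans _ (ltW r1))// [leLHS]/Num.Def.normr/= mx_normrE.
  apply: bigmax_le => // -[i j] _ /=; rewrite ord1.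
  rewrite -(ler_pXn2r (n := 2)) ?nnegrE// expr1n -normrX ger0_norm ?sqr_ge0//.
  rewrite -u1 qE mul1mx dotE (bigD1 j)//= !mxE -expr2 lerDl.
  by rewrite sumr_ge0// => k _; rewrite -expr2 sqr_ge0.
have cA : compact A := bounded_closed_compact bdA clA.
have [|u0 /set_mem Au0 u0min] := compact_EVT_min (f := q S) A0 cA.
  exact/continuous_subspaceT/continuous_quad_form.
pose v0 := u0^T; have [Kv0 v01] : K *m v0 = 0 /\ dot v0 v0 = 1.
  by apply/AP; rewrite trmxK.
pose a := dot v0 (S *m v0).
have amin v : K *m v = 0 -> a * dot v v <= dot v (S *m v).
  move=> Kv; have [->|vn0] := eqVneq v 0; first by rewrite mulmx0 !dot0r mulr0.
  have /mem_set/u0min := normalA v vn0 Kv.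
  rewrite !qE trmxK -/v0 -/a -scalemxAr !dot_lin mulrA -invrM; last 2 first.
  - by rewrite unitfE -sqrf_eq0 enorm_sqr dot_eq0.
  - by rewrite unitfE -sqrf_eq0 enorm_sqr dot_eq0.
  by rewrite -expr2 enorm_sqr mulrC ler_pdivlMr ?dot_gt0.
suff Sv0 : S *m v0 = a *: v0.
  apply: le_trans (amin _ Kw); rewrite ler_wpM2r ?dot_ge0//.
  by apply: hl Sv0 => //; rewrite -dot_eq0 v01 oner_eq0.
(* The residual [d] stays in the kernel of [K], so [amin] applies to [v0 - s *: d] for every [s].
   This is a quadratic in [s] with constant term 0 and linear coefficient [- 2 |d|^2]; its
   discriminant forces [d = 0]. *)
have [d dE] : exists d, d = S *m v0 - a *: v0 by eexists.
have Kd : K *m d = 0 by rewrite dE mulmxBr KS// -scalemxAr Kv0 scaler0 subr0.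
have dd : dot d d = dot d (S *m v0) - a * dot d v0.
  by rewrite {2}dE dotBr dotZr.
have symS u v : dot u (S *m v) = dot v (S *m u) by rewrite dot_mulmx ST dotC.
have : dot d d ^+ 2 <= 0 * (dot d (S *m d) - a * dot d d).
  apply: discr_le => [|s]; first by rewrite subr_ge0 amin.
  have := amin (v0 - s *: d); rewrite mulmxBr Kv0 -scalemxAr Kd scaler0 subr0.
  move=> /(_ erefl); rewrite mulmxBr -scalemxAr !dot_lin v01 -/a -subr_ge0 dd.
  rewrite (symS v0 d) (dotC v0 d).
  by congr (_ <= _); ring.
rewrite mul0r => dle; apply/eqP; rewrite -subr_eq0 -dot_eq0 -dE.
by rewrite -sqrf_eq0 eq_le dle sqr_ge0.
Qed.

End Rayleigh.

(** * Singular values as bounds on a matrix and on its transpose *)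

Section SingularValues.
Variables (R : realType) (N P : nat) (A : 'M[R]_(N, P)).

(** [eigenvalue] refers to row eigenvectors, so [v] is transposed, the Gram matrix being symmetric;
    the sign of [a] follows from [a |v|^2 = |A v|^2]. *)
Lemma gram_eigenvectorP a (v : 'cV[R]_P) : v != 0 ->
  A^T *m A *m v = a *: v -> 0 <= a /\ singular_value A (Num.sqrt a).
Proof.
move=> v0 Av.
have a0 : 0 <= a.
  have : 0 <= a * dot v v by rewrite -dotZr -Av -mulmxA dot_mulmx trmxK dot_ge0.
  by rewrite pmulr_lge0 ?dot_gt0.
split=> //; split; first exact: sqrtr_ge0.
rewrite sqr_sqrtr//; apply/eigenvalueP; exists v^T; last by rewrite trmx_eq0.
by apply: trmx_inj; rewrite !(trmx_mul, linearZ)/= !trmxK.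
Qed.

Lemma singular_value_lower (g : R) : 0 <= g ->
  (forall s, singular_value A s -> g <= s) ->
  forall v, g ^+ 2 * dot v v <= dot (A *m v) (A *m v).
Proof.
move=> g0 gle v; have -> : dot (A *m v) (A *m v) = dot v (A^T *m A *m v).
  by rewrite -mulmxA [RHS]dot_mulmx trmxK.
(* A constraint matrix without rows leaves the whole space. *)
apply: (rayleigh_ge (K := (0 : 'M[R]_(0, P)))); rewrite ?mul0mx//.
- by rewrite trmx_mul trmxK.
- by move=> w _; rewrite mul0mx.
move=> a w _ w0 /gram_eigenvectorP -/(_ w0)[a0 /gle gs].
by rewrite -(sqr_sqrtr a0) ler_pXn2r ?nnegrE ?sqrtr_ge0.
Qed.

(** The lower Rayleigh bound is applied to [- (A^T *m A)]. *)
Lemma singular_value_upper (G : R) :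
  (forall s, singular_value A s -> s <= G) ->
  forall v, dot (A *m v) (A *m v) <= G ^+ 2 * dot v v.
Proof.
move=> leG v; rewrite -lerN2 -mulNr.
have -> : - dot (A *m v) (A *m v) = dot v (- (A^T *m A) *m v).
  by rewrite mulNmx dotNr -mulmxA [in RHS]dot_mulmx trmxK.
apply: (rayleigh_ge (K := (0 : 'M[R]_(0, P)))); rewrite ?mul0mx//.
- by rewrite linearN/= trmx_mul trmxK.
- by move=> w _; rewrite mul0mx.
move=> a w _ w0 /eqP; rewrite mulNmx eqr_oppLR -scaleNr => /eqP.
move=> /gram_eigenvectorP -/(_ w0)[a0 /leG sG].
rewrite lerNl -(sqr_sqrtr a0) ler_pXn2r ?nnegrE ?sqrtr_ge0//.
(* The sign of [G] comes from the singular value at hand, which lies between 0 and [G]. *)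
by rewrite (le_trans _ sG) ?sqrtr_ge0.
Qed.

(** Turns the column space into a kernel, the form of constraint that [rayleigh_ge] accepts. *)
Lemma in_colspaceP (u : 'cV[R]_N) :
  in_colspace A u <-> (cokermx A^T)^T *m u = 0.
Proof.
split=> [[w ->]|h].
  by rewrite -{2}(trmxK A) mulmxA -(trmx_mul A^T) mulmx_coker trmx0 mul0mx.
have /submxP[D uD] : (u^T <= A^T)%MS.
  by rewrite submxE; apply/eqP/trmx_inj; rewrite (trmx_mul u^T) trmxK h trmx0.
by exists D^T; apply: trmx_inj; rewrite uD trmx_mul trmxK.
Qed.

(* On the column space, A A^T is invertible and shares its eigenvalues with the
   nonzero spectrum of A^T A. *)
Lemma nonzero_singular_value_lower (g : R) : 0 <= g ->
  (forall s, singular_value A s -> s != 0 -> g <= s) ->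
  forall u, in_colspace A u -> g ^+ 2 * dot u u <= dot (A^T *m u) (A^T *m u).
Proof.
move=> g0 gle u /in_colspaceP Ku.
have -> : dot (A^T *m u) (A^T *m u) = dot u (A *m A^T *m u).
  by rewrite -mulmxA [RHS]dot_mulmx.
apply: rayleigh_ge Ku; first by rewrite trmx_mul trmxK.
  by move=> v _; apply/in_colspaceP; exists (A^T *m v); rewrite mulmxA.
move=> a v /in_colspaceP[y vy] v0 AAv.
(* As [v = A *m y], [|v|^2 = <A^T v, y>], so [A^T] does not kill [v]; [A^T *m v] is then an
   eigenvector of [A^T *m A] for the same [a]. *)
have Av0 : A^T *m v != 0.
  apply: contra v0 => /eqP Av0.
  by rewrite -dot_eq0 {2}vy dot_mulmx Av0 dotC dot0r.
have [|a0 sv] := @gram_eigenvectorP a _ Av0.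
  by rewrite -mulmxA (mulmxA A) AAv -scalemxAr.
have an0 : a != 0.
  apply: contra Av0 => /eqP a00.
  by rewrite -dot_eq0 -dot_mulmx mulmxA AAv a00 scale0r dot0r.
rewrite -(sqr_sqrtr a0) ler_pXn2r ?nnegrE ?sqrtr_ge0//.
by apply: gle; rewrite // sqrtr_eq0 -ltNge lt0r an0.
Qed.

End SingularValues.

(** * Derivatives along lines through the gradient and the Hessian *)

Section LineDerivative.
Variable R : realType.

Lemma is_derive_line (V : normedModType R) (h : V -> R) (x d : V) (t l : R) :
  is_derive (x + t *: d) d h l -> is_derive t 1 (fun s => h (x + s *: d)) l.
Proof.
move=> [dh <-].
have E : (fun s : R => s^-1 *: (h (x + (s *: 1 + t) *: d) - h (x + t *: d))) =
         (fun s : R => s^-1 *: (h (s *: d + (x + t *: d)) - h (x + t *: d))).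
  by apply/funext => s; rewrite scalerDl -scalerA scale1r addrCA.
apply: DeriveDef; first by rewrite /derivable; move: dh; rewrite /derivable -E.
by rewrite /derive -E.
Qed.

Lemma is_derive_delta N (h : 'cV[R]_N -> R) (y v : 'cV[R]_N) :
  differentiable h y ->
  is_derive y v h (\sum_l 'D_(delta_mx l 0) h y * v l 0).
Proof.
move=> dh; apply: DeriveDef; first exact: diff_derivable.
rewrite deriveE// [in LHS](matrix_sum_delta v) linear_sum; apply: eq_bigr => l _.
by rewrite big_ord1 linearZ/= deriveE// mulrC.
Qed.

Lemma is_derive_grad N (g : 'cV[R]_N -> R) (y v : 'cV[R]_N) :
  differentiable g y -> is_derive y v g (dot (grad g y) v).
Proof.
move=> dg; rewrite dotE; under eq_bigr do rewrite mxE.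
exact: is_derive_delta.
Qed.

Lemma is_derive_grad_coord N (g : 'cV[R]_N -> R) (y v : 'cV[R]_N) i :
  twice_differentiable g ->
  is_derive y v (fun y => grad g y i 0) ((hess g y *m v) i 0).
Proof.
move=> [_ dg]; rewrite mxE; under eq_bigr do rewrite mxE.
apply: is_derive_delta.
exact: (differentiable_comp (dg y) (differentiable_coord (grad g y) i 0)).
Qed.

Lemma is_derive_dot_grad N (g : 'cV[R]_N -> R) (w x d : 'cV[R]_N) (t : R) :
  twice_differentiable g ->
  is_derive t 1 (fun s => dot w (grad g (x + s *: d)))
    (dot w (hess g (x + t *: d) *m d)).
Proof.
move=> dg; rewrite (_ : (fun _ => _) =
    \sum_i (w i 0 *: (fun s : R => grad g (x + s *: d) i 0))); last first.
  by apply/funext => s; rewrite dotE fct_sumE; apply: eq_bigr.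
rewrite dotE; apply: is_derive_sum => i.
apply: is_deriveZ; apply: (@is_derive_line _ (fun y => grad g y i 0)).
exact: is_derive_grad_coord.
Qed.

End LineDerivative.

(** * Strong convexity, Lipschitz gradient and linearization error of one local cost *)

Section SmoothStronglyConvex.
Variables (R : realType) (N : nat) (g : 'cV[R]_N -> R) (m M L : R).
Hypothesis dg : twice_differentiable g.
Hypotheses (m_gt0 : 0 < m) (m_le_M : m <= M).
Hypothesis hess_bounds :
  forall y, loewner_le m%:M (hess g y) /\ loewner_le (hess g y) M%:M.
Hypothesis hess_lip :
  forall y y', spectral_norm (hess g y - hess g y') <= L * enorm (y - y').

Lemma hess_ge y v : m * dot v v <= dot v (hess g y *m v).
Proof.
have [[_ /(_ v)]] := hess_bounds y.
by rewrite quadE mulmxBl mul_scalar_mx dotBr dotZr subr_ge0.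
Qed.

Lemma hess_le y v : dot v (hess g y *m v) <= M * dot v v.
Proof.
have [_ [_ /(_ v)]] := hess_bounds y.
by rewrite quadE mulmxBl mul_scalar_mx dotBr dotZr subr_ge0.
Qed.

Lemma hess_psd y : psd (hess g y).
Proof.
split=> [|v]; last first.
  by rewrite quadE (le_trans _ (hess_ge y v))// mulr_ge0 ?dot_ge0// ltW.
have [[+ _] _] := hess_bounds y.
by rewrite linearB/= tr_scalar_mx => /addIr.
Qed.

Let M_ge0 : 0 <= M := le_trans (ltW m_gt0) m_le_M.

(** The form bound passes to the operator by Cauchy-Schwarz for the Hessian form:
    [<w, H v>^2 <= <w, H w> <v, H v>]. *)
Lemma enorm_hess_le y v : enorm (hess g y *m v) <= M * enorm v.
Proof.
apply: enorm_le_dot => [|w]; first by rewrite mulr_ge0 ?enorm_ge0.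
have [|/ltW d0] := lerP (dot w (hess g y *m v)) 0.
  by move=> /le_trans; apply; rewrite !mulr_ge0 ?enorm_ge0.
rewrite -(ler_pXn2r (n := 2)) ?nnegrE ?mulr_ge0 ?enorm_ge0//.
rewrite (le_trans (psd_cauchy_schwarz _ _ (hess_psd y)))//.
rewrite !exprMn !enorm_sqr [leRHS](_ : _ = M * dot w w * (M * dot v v)); last by ring.
by rewrite ler_pM ?hess_le// -quadE; case: (hess_psd y).
Qed.

(* The terms a and K let one mean value step serve both the first-order bounds
   (a = K = 0) and the quadratic remainder bound. *)
Lemma grad_mvt (w x d : 'cV[R]_N) (a K : R) :
  exists2 s, 0 <= s & dot w (grad g (x + d) - grad g x) - a - K =
    dot w (hess g (x + s *: d) *m d) - a - 2 * s * K.
Proof.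
pose f (t : R) := dot w (grad g (x + t *: d)) - t * a - t ^+ 2 * K.
pose df t := dot w (hess g (x + t *: d) *m d) - a - 2 * t * K.
have fdf (t : R) : is_derive t 1 f (df t).
  have h := is_derive_dot_grad w x d t dg.
  apply: is_derive_eq.
  by rewrite /df !scaler0 !add0r /GRing.scale/=; ring.
have cf : {within `[0, 1], continuous f}%classic.
  apply: continuous_subspaceT => t; apply: differentiable_continuous.
  by apply/derivable1_diffP; exact: (@ex_derive _ _ _ _ _ _ _ (fdf t)).
have [s] := MVT_segment ler01 (fun t _ => fdf t) cf.
rewrite in_itv/= => /andP[s0 _]; rewrite subr0 mulr1 => E; exists s => //.
rewrite -[RHS]/(df s) -E /f !scale1r !scale0r !addr0 dotBr; ring.
Qed.

Lemma grad_monotone x d : m * dot d d <= dot d (grad g (x + d) - grad g x).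
Proof.
have [s _] := grad_mvt d x d 0 0.
by rewrite mulr0 !subr0 => ->; exact: hess_ge.
Qed.

Lemma grad_lipschitz x d : enorm (grad g (x + d) - grad g x) <= M * enorm d.
Proof.
apply: enorm_le_dot => [|w]; first by rewrite mulr_ge0 ?enorm_ge0.
have [s _] := grad_mvt w x d 0 0; rewrite mulr0 !subr0 => ->.
by rewrite (le_trans (dot_le_enorm _ _))// mulrC ler_wpM2r ?enorm_ge0 ?enorm_hess_le.
Qed.

(** Stated for the product because in dimension 0 the sign of [L] is undetermined. *)
Lemma hess_lip_ge0 (d : 'cV[R]_N) : 0 <= L * enorm d.
Proof.
by have := hess_lip d 0; rewrite subr0; apply: le_trans; exact: spectral_norm_ge0.
Qed.

Let err x d := grad g x + hess g x *m d - grad g (x + d).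

(** The derivative in [grad_mvt] becomes [<w, (H(x + s d) - H(x)) d> - 2 s K], nonpositive by
    [hess_lip]. The term [t^2 K] produces the factor 1/2 without integration. *)
Lemma grad_error_quadratic x d : enorm (err x d) <= L / 2 * enorm d * enorm d.
Proof.
rewrite -enormN; apply: enorm_le_dot => [|w].
  apply: mulr_ge0 (enorm_ge0 _); rewrite mulrAC.
  by apply: mulr_ge0 (hess_lip_ge0 _) _; rewrite invr_ge0.
rewrite /err opprB opprD addrA dotBr.
set K := _ * enorm w; pose a := dot w (hess g x *m d).
have [s s0 E] := grad_mvt w x d a K.
rewrite -subr_le0 -/a E subr_le0 -dotBr -mulmxBl.
rewrite (le_trans (dot_le_enorm _ _))// mulrC.
rewrite (_ : 2 * s * K = L * (s * enorm d) * enorm d * enorm w); last first.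
  by rewrite /K; field.
rewrite ler_wpM2r ?enorm_ge0// (le_trans (spectral_norm_le _ _))//.
rewrite ler_wpM2r ?enorm_ge0// (le_trans (hess_lip _ _))//.
by rewrite addrAC subrr add0r enormZ ger0_norm.
Qed.

(** The Hessian term and the gradient increment cost [M |d|] each, whence the cap [2 * M] in
    [zeta]. *)
Lemma grad_error_linear x d : enorm (err x d) <= 2 * M * enorm d.
Proof.
rewrite /err addrAC (le_trans (enormD _ _))//.
rewrite (_ : 2 * M * _ = M * enorm d + M * enorm d); last by ring.
apply: lerD (enorm_hess_le _ _).
by rewrite -opprB enormN grad_lipschitz.
Qed.

End SmoothStronglyConvex.

(** * Separable cost: from blocks to stacked vectors *)

Section TotalCost.
Variables (R : realType) (n p : nat) (fi : 'I_n -> 'cV[R]_p -> R).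
Hypothesis dfi : forall i, twice_differentiable (fi i).
Implicit Types x v : nodevec R n p.

Lemma dot_blocks x v : dot x v = \sum_i dot (submxcol x i) (submxcol v i).
Proof.
rewrite /dot -{1}(submxcolK x) -{1}(submxcolK v) tr_mxcol mul_mxrow_mxcol.
by rewrite summxE.
Qed.

Lemma dot_delta N (u : 'cV[R]_N) s : dot u (delta_mx s 0) = u s 0.
Proof.
rewrite dotE (bigD1 s)//= big1 => [|i /negPf si]; rewrite !mxE ?eqxx ?mulr1 ?addr0//.
by rewrite si mulr0.
Qed.

Lemma is_derive_submxcol (h : 'cV[R]_p -> R) i x v l :
  is_derive (submxcol x i) (submxcol v i) h l ->
  is_derive x v (fun y => h (submxcol y i)) l.
Proof.
move=> [dh <-].
have E : (fun s : R => s^-1 *: (h (submxcol (s *: v + x) i) - h (submxcol x i))) =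
    (fun s : R => s^-1 *: (h (s *: submxcol v i + submxcol x i) - h (submxcol x i))).
  apply/funext => s; rewrite submxcolD; congr (_ *: (h (_ + _) - _)).
  by apply/matrixP => a b; rewrite !mxE.
apply: DeriveDef; first by move: dh; rewrite /derivable -E.
by rewrite /derive -E.
Qed.

Lemma grad_total_cost x :
  grad (total_cost fi) x = \mxcol_i grad (fi i) (submxcol x i).
Proof.
(* Pairing with a basis vector reads off entry [s] without splitting the index into block and
   position. *)
apply/colP => s; rewrite -[RHS]dot_delta dot_blocks mxE.
rewrite (_ : total_cost fi = \sum_i (fun y : nodevec R n p => fi i (submxcol y i))).
  apply: derive_val; apply: is_derive_sum => i; rewrite mxcolK.
  exact/is_derive_submxcol/is_derive_grad/(dfi i).1.
by apply/funext => y; rewrite fct_sumE.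
Qed.

Lemma submxcol_grad x i :
  submxcol (grad (total_cost fi) x) i = grad (fi i) (submxcol x i).
Proof. by rewrite grad_total_cost mxcolK. Qed.

(** The Hessian of a separable sum is block diagonal; this is expressed by its action on [v],
    expanded in the standard basis. *)
Lemma submxcol_hess_mul x v i :
  submxcol (hess (total_cost fi) x *m v) i =
  hess (fi i) (submxcol x i) *m submxcol v i.
Proof.
suff -> : hess (total_cost fi) x *m v =
    \mxcol_i (hess (fi i) (submxcol x i) *m submxcol v i) by rewrite mxcolK.
apply/colP => s; rewrite !mxE; set j := tagnat.sig1 s; set k := tagnat.sig2 s.
have vE : v = \sum_t v t 0 *: delta_mx t 0.
  by rewrite {1}[v]matrix_sum_delta; apply: eq_bigr => t _; rewrite big_ord1.
transitivity (\sum_t (hess (fi j) (submxcol x j) *m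
    submxcol (delta_mx t 0 : nodevec R n p) j) k 0 * v t 0).
  apply: eq_bigr => t _; congr (_ * _); rewrite mxE.
  rewrite (_ : (fun y => _) = fun y : nodevec R n p => grad (fi j) (submxcol y j) k 0);
    last by apply/funext => y; rewrite grad_total_cost mxE.
  apply: derive_val; apply: (is_derive_submxcol (h := fun y => grad (fi j) y k 0)).
  exact: is_derive_grad_coord.
have -> : \sum_l hess (fi j) (submxcol x j) k l * submxcol v j l 0 =
    (hess (fi j) (submxcol x j) *m submxcol v j) k 0 by rewrite mxE.
rewrite {2}vE submxcol_sum mulmx_sumr summxE; apply: eq_bigr => t _.
rewrite (_ : submxcol (_ *: _) _ = v t 0 *: submxcol (delta_mx t 0) j).
  by rewrite -scalemxAr [RHS]mxE mulrC.
by apply/matrixP => a b; rewrite !mxE.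
Qed.

Variables (m M L : R).
Hypotheses (m_gt0 : 0 < m) (m_le_M : m <= M).
Hypothesis hess_bounds : forall i y,
  loewner_le m%:M (hess (fi i) y) /\ loewner_le (hess (fi i) y) M%:M.
Hypothesis hess_lip : forall i y y',
  spectral_norm (hess (fi i) y - hess (fi i) y') <= L * enorm (y - y').

Let f := total_cost fi.

Let submxcol_line x y i :
  submxcol y i = submxcol x i + submxcol (y - x) i.
Proof. by rewrite submxcolB addrC subrK. Qed.

Lemma total_grad_monotone x y :
  m * dot (y - x) (y - x) <= dot (y - x) (grad f y - grad f x).
Proof.
rewrite !dot_blocks mulr_sumr ler_sum// => i _.
rewrite (submxcolB (grad f y)) !submxcol_grad (submxcol_line x y).
exact: (grad_monotone (dfi i) (hess_bounds i)).
Qed.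

Lemma total_grad_lipschitz x y :
  dot (grad f y - grad f x) (grad f y - grad f x) <=
  M ^+ 2 * dot (y - x) (y - x).
Proof.
rewrite !dot_blocks mulr_sumr ler_sum// => i _.
rewrite (submxcolB (grad f y)) !submxcol_grad (submxcol_line x y).
exact/dot_le_enormM/(grad_lipschitz (dfi i) m_gt0).
Qed.

Lemma enorm_submxcol_le x i : enorm (submxcol x i) <= enorm x.
Proof.
rewrite !enormE ler_wsqrtr// (dot_blocks x x) (bigD1 i)//= lerDl.
by rewrite sumr_ge0// => j _; exact: dot_ge0.
Qed.

(** With this sign the linearized gradient equals [grad f y] plus the error. *)
Definition grad_error x y := grad f x + hess f x *m (y - x) - grad f y.

Lemma submxcol_grad_error x y i : submxcol (grad_error x y) i =
  grad (fi i) (submxcol x i) + hess (fi i) (submxcol x i) *m submxcol (y - x) i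
    - grad (fi i) (submxcol x i + submxcol (y - x) i).
Proof.
rewrite /grad_error submxcolB submxcolD !submxcol_grad submxcol_hess_mul.
by rewrite -submxcol_line.
Qed.

(** A nonzero [x] has a nonzero block, where the one-block statement forces [0 <= L]. *)
Lemma total_lip_ge0 x : 0 <= L * enorm x.
Proof.
have [->|x0] := eqVneq x 0; first by rewrite enormE dot0r sqrtr0 mulr0.
suff L0 : 0 <= L by rewrite mulr_ge0 ?enorm_ge0.
have : dot x x != 0 by rewrite dot_eq0.
rewrite dot_blocks; apply: contraNT; rewrite -ltNge => L0.
rewrite big1// => i _; apply/eqP; rewrite dot_eq0; apply/negPn/negP => xi0.
have := hess_lip_ge0 (hess_lip i) (submxcol x i).
by rewrite nmulr_rge0// leNgt enormE sqrtr_gt0 dot_gt0.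
Qed.

Lemma enorm_grad_error x y :
  enorm (grad_error x y) <=
  Num.min (L / 2 * enorm (y - x)) (2 * M) * enorm (y - x).
Proof.
set d := y - x; set z := Num.min _ _.
have M0 : 0 <= M := le_trans (ltW m_gt0) m_le_M.
have Ld0 : 0 <= L / 2 * enorm d.
  by rewrite mulrAC mulr_ge0 ?total_lip_ge0 ?invr_ge0.
have block_le (a : R) : 0 <= a ->
    (forall i, enorm (submxcol (grad_error x y) i) <= a * enorm (submxcol d i)) ->
    enorm (grad_error x y) <= a * enorm d.
  move=> a0 h; apply: enorm_le_dotM => //.
  rewrite !dot_blocks mulr_sumr ler_sum// => i _; exact/dot_le_enormM/h.
rewrite /z /Num.min; case: ifP => _; apply: block_le; rewrite ?Ld0 ?mulr_ge0// => i;
  rewrite submxcol_grad_error -/d; last exact: (grad_error_linear (dfi i) m_gt0).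
rewrite (le_trans (grad_error_quadratic (dfi i) (hess_lip i) _ _))//.
rewrite ler_wpM2r ?enorm_ge0//.
(* The sign of [L / 2] is recovered from [Ld0] by cancelling [enorm d], hence the case split. *)
have [d0|d0] := eqVneq (enorm d) 0.
  have di0 : enorm (submxcol d i) = 0.
    by apply/eqP; rewrite eq_le enorm_ge0 andbT -d0 enorm_submxcol_le.
  by rewrite d0 di0.
rewrite ler_wpM2l ?enorm_submxcol_le//.
by move: Ld0; rewrite pmulr_lge0// lt0r d0 enorm_ge0.
Qed.

End TotalCost.

(** * One-step energy estimate for abstract vectors *)

Section Contraction.
Variables (R : realType) (N P : nat) (Eo Eu : 'M[R]_(P, N)).
Variables (c m M gu Gu go mu mu' eta zeta : R).
Hypotheses (c0 : 0 < c) (m0 : 0 < m) (mM : m <= M) (gu0 : 0 < gu) (go0 : 0 < go).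
Hypotheses (Gu0 : 0 < Gu ^+ 2) (mu1 : 1 < mu) (mu'1 : 1 < mu').
Hypotheses (zeta0 : 0 <= zeta) (eta_gt : zeta / m < eta).
Hypothesis eta_lt : zeta != 0 -> eta < c * gu ^+ 2 / zeta.

Let rate_z := (mu - 1) * (c * gu ^+ 2 - eta * zeta) * go ^+ 2
  / (mu * mu' * (c * Gu ^+ 2 * gu ^+ 2 + 4 * zeta ^+ 2 / (c * (mu' - 1)))).
Let rate_x := (m - zeta / eta) / (c * Gu ^+ 2 / 4 + mu * M ^+ 2 / (c * go ^+ 2)).
(** [px] and [pz] are the coefficients of [|dx|^2] and [|az|^2] in the upper bound [energy_le]. *)
Let px := c * Gu ^+ 2 / 4 + mu * M ^+ 2 / (c * go ^+ 2).
Let pz := (c * go ^+ 2)^-1 * (mu / (mu - 1) *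
  (mu' * (c ^+ 2 * Gu ^+ 2) + mu' / (mu' - 1) * (4 * zeta ^+ 2 / gu ^+ 2))).

Let eta0 : 0 < eta.
Proof. by apply: le_lt_trans eta_gt; rewrite divr_ge0// ltW. Qed.

Let x_slack_gt0 : 0 < m - zeta / eta.
Proof. by rewrite subr_gt0 ltr_pdivrMr// mulrC -ltr_pdivrMr. Qed.

Let z_slack_gt0 : 0 < c * gu ^+ 2 - eta * zeta.
Proof.
(* For [zeta = 0] the right endpoint for [eta] is infinite, and the slack is [c * gu ^+ 2]. *)
have [->|zn0] := eqVneq zeta 0; first by rewrite mulr0 subr0 mulr_gt0// exprn_gt0.
by rewrite subr_gt0 -ltr_pdivlMr ?eta_lt// lt0r zn0.
Qed.

Let mu0 : 0 < mu. Proof. exact: lt_trans mu1. Qed.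
Let mu'0 : 0 < mu'. Proof. exact: lt_trans mu'1. Qed.
Let mum0 : 0 < mu - 1. Proof. by rewrite subr_gt0. Qed.
Let mu'm0 : 0 < mu' - 1. Proof. by rewrite subr_gt0. Qed.
Let M0 : 0 < M. Proof. exact: lt_le_trans mM. Qed.

Let px_gt0 : 0 < px.
Proof.
by apply: addr_gt0; apply: divr_gt0 => //;
  by rewrite mulr_gt0// exprn_gt0.
Qed.

Let z_den_gt0 : 0 < c * Gu ^+ 2 * gu ^+ 2 + 4 * zeta ^+ 2 / (c * (mu' - 1)).
Proof.
apply: ltr_wpDr; last first.
  by apply: mulr_gt0; [exact: mulr_gt0|exact: exprn_gt0].
by apply: divr_ge0; [rewrite mulr_ge0 ?sqr_ge0|rewrite ltW ?mulr_gt0].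
Qed.

Lemma rate_gt0 : 0 < Num.min rate_z rate_x.
Proof.
rewrite lt_min; apply/andP; split; apply: divr_gt0 => //.
  by rewrite !mulr_gt0 ?exprn_gt0.
by rewrite !mulr_gt0.
Qed.

(** Identifies [rate_z] as a drop coefficient divided by [pz]: once [mu' * c / gu ^+ 2] is factored
    out of the bracket in [pz], the denominator of [rate_z] cancels. *)
Let rate_zE : rate_z * pz = c - eta * zeta / gu ^+ 2.
Proof.
rewrite /rate_z /pz.
have h : mu' * (c ^+ 2 * Gu ^+ 2) + mu' / (mu' - 1) * (4 * zeta ^+ 2 / gu ^+ 2) =
    mu' * c / gu ^+ 2 *
      (c * Gu ^+ 2 * gu ^+ 2 + 4 * zeta ^+ 2 / (c * (mu' - 1))).
  by field; rewrite !lt0r_neq0.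
rewrite h; move: (lt0r_neq0 z_den_gt0); set D := c * Gu ^+ 2 * _ + _ => D0.
by field; rewrite D0 !lt0r_neq0.
Qed.

(** [dx], [dz], [da] are the new errors in x, z, alpha relative to the optimum; [d], [az], [aa] are
    the increments from step [k] to [k.+1]. [gF] is the gradient difference to the optimum and [e]
    the model error. *)
Variables (dx d gF e : 'cV[R]_N) (dz az da aa : 'cV[R]_P).
Hypothesis kkt : gF + e + Eo^T *m da + c *: (Eu^T *m az) = 0.
Hypothesis aaE : aa = (c / 2) *: (Eo *m dx).
Hypotheses (dzE : Eu *m dx = 2 *: dz) (azE : Eu *m d = 2 *: az).
Hypothesis gF_mono : m * dot dx dx <= dot dx gF.
Hypothesis gF_lip : dot gF gF <= M ^+ 2 * dot dx dx.
Hypothesis e_le : enorm e <= zeta * enorm d.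
Hypothesis Eu_ge : forall v, gu ^+ 2 * dot v v <= dot (Eu *m v) (Eu *m v).
Hypothesis Eu_le : forall v, dot (Eu *m v) (Eu *m v) <= Gu ^+ 2 * dot v v.
Hypothesis Eo_ge : go ^+ 2 * dot da da <= dot (Eo^T *m da) (Eo^T *m da).

Let d_le : dot d d <= 4 / gu ^+ 2 * dot az az.
Proof.
rewrite mulrAC ler_pdivlMr ?exprn_gt0// mulrC (le_trans (Eu_ge _))//.
by rewrite azE !dot_lin; lra.
Qed.

Let dz_le : dot dz dz <= Gu ^+ 2 / 4 * dot dx dx.
Proof.
rewrite mulrAC ler_pdivlMr// mulrC (le_trans _ (Eu_le _))//.
by rewrite dzE !dot_lin; lra.
Qed.

(** Pairing [kkt] with [dx] yields exactly the cross terms of the expanded squares: [Eo *m dx] is a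
    multiple of [aa] and [Eu *m dx] of [dz]. The square of [aa] is dropped, and Young's inequality
    with weight [eta] absorbs the error [e]. *)
Let energy_drop : (m - zeta / eta) * dot dx dx + (c - eta * zeta / gu ^+ 2) * dot az az
  <= (c * dot (dz - az) (dz - az) + c^-1 * dot (da - aa) (da - aa))
     - (c * dot dz dz + c^-1 * dot da da).
Proof.
have E1 : dot dx gF + dot dx e + 2 * (c^-1 * dot aa da) + 2 * (c * dot dz az) = 0.
  rewrite -[RHS](dot0r dx) -kkt !dot_lin !dot_mulmx !trmxK dzE aaE !dot_lin.
  by field; rewrite lt0r_neq0.
have E2 : - (dot dx dx * (zeta / eta) + eta * zeta / 4 * dot d d) <= dot dx e.
  rewrite lerNl -dotNr (le_trans (dot_le_enorm _ _))// enormN.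
  apply: (@le_trans _ _ (enorm dx * (zeta * enorm d))).
    by rewrite ler_wpM2l ?enorm_ge0.
  (* Young: a b <= a^2 / eta + eta b^2 / 4 *)
  rewrite -!enorm_sqr -subr_ge0; move: (enorm dx) (enorm d) => a b.
  rewrite (_ : _ - _ = zeta / (4 * eta) * (2 * a - eta * b) ^+ 2).
    by rewrite mulr_ge0 ?sqr_ge0// divr_ge0// mulr_ge0// ltW.
  by field; rewrite lt0r_neq0.
have E3 : eta * zeta / 4 * dot d d <= eta * zeta / gu ^+ 2 * dot az az.
  apply: (@le_trans _ _ (eta * zeta / 4 * (4 / gu ^+ 2 * dot az az))).
    by rewrite ler_wpM2l// divr_ge0// mulr_ge0// ltW.
  by rewrite le_eqVlt; apply/orP; left; apply/eqP; field; rewrite lt0r_neq0.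
have E4 : 0 <= c^-1 * dot aa aa by rewrite mulr_ge0 ?dot_ge0// invr_ge0 ltW.
rewrite !dot_lin (dotC az dz) (dotC da aa).
move: E1 E2 E3 E4 gF_mono; lra.
Qed.

(** By [kkt], [Eo^T *m da = - (gF + w)]; the weight [mu] separates [gF] from [w], and [mu']
    separates the two terms of [w]. *)
Let energy_le : c * dot dz dz + c^-1 * dot da da <= px * dot dx dx + pz * dot az az.
Proof.
have H1 : c * dot dz dz <= c * Gu ^+ 2 / 4 * dot dx dx.
  by rewrite -(mulrA c) -(mulrA c) ler_pM2l.
pose w := e + c *: (Eu^T *m az).
have H2 : dot (c *: (Eu^T *m az)) (c *: (Eu^T *m az)) <= c ^+ 2 * Gu ^+ 2 * dot az az.
  rewrite !dot_lin mulrA -expr2 -mulrA ler_pM2l ?exprn_gt0//.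
  exact: dot_trmx_le (ltW Gu0) Eu_le _.
have H3 : dot e e <= 4 * zeta ^+ 2 / gu ^+ 2 * dot az az.
  rewrite (le_trans (dot_le_enormM e_le))//.
  rewrite (_ : 4 * _ / _ * _ = zeta ^+ 2 * (4 / gu ^+ 2 * dot az az)); last by ring.
  by rewrite ler_wpM2l ?sqr_ge0.
have H4 : dot w w <= (mu' * (c ^+ 2 * Gu ^+ 2)
    + mu' / (mu' - 1) * (4 * zeta ^+ 2 / gu ^+ 2)) * dot az az.
  rewrite /w addrC (le_trans (dotDD_le _ _ mu'1))// mulrDl.
  by apply: lerD; rewrite -[leRHS]mulrA ler_wpM2l// ?divr_ge0// ltW.
pose B := mu * (M ^+ 2 * dot dx dx) + mu / (mu - 1) *
  ((mu' * (c ^+ 2 * Gu ^+ 2)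
    + mu' / (mu' - 1) * (4 * zeta ^+ 2 / gu ^+ 2)) * dot az az).
have H5 : go ^+ 2 * dot da da <= B.
  rewrite (le_trans Eo_ge)// (_ : Eo^T *m da = - (gF + w)); last first.
    apply/eqP; rewrite -addr_eq0 /w; apply/eqP.
    by rewrite -[RHS]kkt [LHS]addrC !addrA [LHS]addrAC.
  rewrite dotNr dotNl opprK (le_trans (dotDD_le _ _ mu1))//.
  by apply: lerD; rewrite ler_wpM2l// ?divr_ge0// ltW.
have H6 : c^-1 * dot da da <= (c * go ^+ 2)^-1 * B.
  by rewrite invfM -mulrA ler_pM2l ?invr_gt0// ler_pdivlMl ?exprn_gt0.
apply: le_trans (lerD H1 H6) _; rewrite le_eqVlt; apply/orP; left; apply/eqP.
by rewrite /B /px /pz; ring.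
Qed.

(** For [r] the smaller rate, [r V <= r (px |dx|^2 + pz |az|^2) <= V0 - V], that is
    [V <= V0 / (1 + r)]. *)
Lemma energy_contraction :
  c * dot dz dz + c^-1 * dot da da <=
  1 / (1 + Num.min rate_z rate_x) *
    (c * dot (dz - az) (dz - az) + c^-1 * dot (da - aa) (da - aa)).
Proof.
have := energy_drop; have := energy_le; have := rate_gt0.
have rz : Num.min rate_z rate_x <= rate_z by rewrite ge_min lexx.
have rx : Num.min rate_z rate_x <= rate_x by rewrite ge_min lexx orbT.
move: (Num.min _ _) rz rx => r rz rx r0 Vle Vdrop.
set V := (X in X <= _); set V0 := (X in _ <= _ * X).
have pz0 : 0 <= pz.
  apply: mulr_ge0; first by rewrite invr_ge0 mulr_ge0 ?sqr_ge0// ltW.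
  apply: mulr_ge0; first by rewrite divr_ge0// ltW.
  apply: addr_ge0; apply: mulr_ge0; first exact: ltW.
  - exact: mulr_ge0 (sqr_ge0 c) (ltW Gu0).
  - by rewrite divr_ge0// ltW.
  - by apply: divr_ge0 (sqr_ge0 _); rewrite mulr_ge0 ?sqr_ge0.
have rpx : r * px <= m - zeta / eta by rewrite -ler_pdivlMr.
have rpz : r * pz <= c - eta * zeta / gu ^+ 2 by rewrite -rate_zE ler_wpM2r.
have rV : r * V <= V0 - V.
  apply: (le_trans _ Vdrop); apply: (@le_trans _ _ (r * (px * dot dx dx + pz * dot az az))).
    by rewrite ler_pM2l.
  by rewrite mulrDr (mulrA r px) (mulrA r pz) lerD// ler_wpM2r ?dot_ge0.
by rewrite div1r mulrC ler_pdivlMr ?addr_gt0// mulrDr mulr1 mulrC -lerBrDl.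
Qed.

End Contraction.

(** * Elimination of [beta] and [z] from the recursion *)

Section DQM.
Variables (R : realType) (n p : nat) (E : {set 'I_n * 'I_n}).
Variables (f : nodevec R n p -> R) (c : R).
Variables (x : nat -> nodevec R n p) (z alpha beta : nat -> edgevec R p E).
Let Eo := oriented_inc R p E.
Let Eu := unoriented_inc R p E.
Hypothesis c0 : 0 < c.
Hypothesis dqm : dqm_recursion f c x z alpha beta.
Hypotheses (alpha_beta0 : alpha 0%N = - beta 0%N) (Eu_x0 : Eu *m x 0%N = 2 *: z 0%N).

Lemma quad_energy_mx (a b : edgevec R p E) :
  quad (energy_mx p E c) (col_mx a b) = c * dot a a + c^-1 * dot b b.
Proof.
rewrite /quad /energy_mx tr_col_mx mul_row_block !mulmx0 addr0 add0r mul_row_col.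
by rewrite !mul_mx_scalar -!scalemxAl [LHS]mxE; congr (_ + _); rewrite [LHS]mxE.
Qed.

Lemma constrA_mul (y : nodevec R n p) :
  constrA R p E *m y = col_mx (source_mx R p E *m y) (dest_mx R p E *m y).
Proof. exact: mul_col_mx. Qed.

Lemma constrB_mul (y : edgevec R p E) : constrB R p E *m y = col_mx (- y) (- y).
Proof. by rewrite /constrB mul_col_mx mulNmx mul1mx. Qed.

Lemma constrA_tr_mul (a b : edgevec R p E) :
  (constrA R p E)^T *m col_mx a b = (source_mx R p E)^T *m a + (dest_mx R p E)^T *m b.
Proof. by rewrite /constrA tr_col_mx mul_row_col. Qed.

Lemma constrB_tr_mul (a b : edgevec R p E) :
  (constrB R p E)^T *m col_mx a b = - (a + b).
Proof.
by rewrite /constrB tr_col_mx linearN/= trmx1 mul_row_col !mulNmx !mul1mx opprD.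
Qed.

Lemma constrA_tr_mul_opp (a : edgevec R p E) :
  (constrA R p E)^T *m col_mx a (- a) = Eo^T *m a.
Proof. by rewrite constrA_tr_mul mulmxN -mulmxBl -linearB. Qed.

Lemma dqm_multiplier k :
  alpha k.+1 = alpha k + c *: (source_mx R p E *m x k.+1 - z k.+1) /\
  beta k.+1 = beta k + c *: (dest_mx R p E *m x k.+1 - z k.+1).
Proof.
have [_ _] := dqm k; rewrite constrA_mul constrB_mul add_col_mx scale_col_mx.
rewrite opp_col_mx add_col_mx opp_col_mx add_col_mx => /eqP.
rewrite col_mx_eq0 !subr_eq0 => /andP[/eqP <- /eqP <-].
by rewrite !(addrC _ (_ - _)) !subrK.
Qed.

(** The z-equation and the multiplier update together say that [constrB^T] kills the new multiplier,
    at every step independently of the previous one. *)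
Lemma dqm_alpha_beta k : alpha k = - beta k.
Proof.
case: k => // k; have [aE bE] := dqm_multiplier k; have [_ + _] := dqm k.
rewrite constrA_mul constrB_mul add_col_mx scalemxAr scale_col_mx.
rewrite !constrB_tr_mul aE bE -opprD => /eqP; rewrite oppr_eq0 addrACA.
by rewrite addr_eq0 => /eqP.
Qed.

(** Adding the two multiplier updates cancels [alpha] against [beta] and leaves [c] times the sum of
    the two residuals equal to 0. *)
Lemma dqm_Eu_x k : Eu *m x k = 2 *: z k.
Proof.
case: k => // k; have [aE bE] := dqm_multiplier k.
have h := dqm_alpha_beta k; have := dqm_alpha_beta k.+1.
rewrite aE bE h opprD => /addrI/eqP; rewrite -addr_eq0 -scalerDr scaler_eq0.
rewrite gt_eqF//= addrACA -mulmxDl -opprD subr_eq0 => /eqP ->.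
by rewrite scaler_nat mulr2n.
Qed.

(** Replacing [z] by half of [Eu *m x] turns the source residual into half of [Eo *m x]. *)
Lemma dqm_alpha_step k : alpha k.+1 - alpha k = (c / 2) *: (Eo *m x k.+1).
Proof.
have [-> _] := dqm_multiplier k; rewrite addrAC subrr add0r.
have zE : z k.+1 = 2^-1 *: (Eu *m x k.+1) by rewrite dqm_Eu_x scalerA mulVf ?scale1r.
rewrite zE -scalerA; congr (c *: _); rewrite !mulmxDl mulNmx scalerDr scalerDr scalerN.
rewrite opprD addrA -{1}[source_mx _ _ _ *m _]scale1r -scalerBl.
by congr (_ *: _ + _); field.
Qed.

Lemma dqm_alpha_colspace k : in_colspace Eo (alpha 0%N) -> in_colspace Eo (alpha k).
Proof.
move=> a0; elim: k => // k [w aw].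
exists (w + (c / 2) *: x k.+1).
by rewrite mulmxDr -scalemxAr -dqm_alpha_step -aw addrC subrK.
Qed.

(** Trading [z k] for [z k.+1] lets the penalty term update the multiplier to step [k.+1]; what
    remains is the z increment, through [constrA^T *m constrB = - Eu^T]. *)
Lemma dqm_stationarity k :
  grad f (x k) + hess f (x k) *m (x k.+1 - x k) + Eo^T *m alpha k.+1
    + c *: (Eu^T *m (z k.+1 - z k)) = 0.
Proof.
have [xE _ lE] := dqm k; rewrite -[RHS]xE -!addrA; congr (_ + (_ + _)).
have {lE} lE : c *: (constrA R p E *m x k.+1 + constrB R p E *m z k.+1) =
    col_mx (alpha k.+1) (beta k.+1) - col_mx (alpha k) (beta k).
  by move/eqP: lE; rewrite subr_eq0 => /eqP.
have -> : constrA R p E *m x k.+1 + constrB R p E *m z k =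
    (constrA R p E *m x k.+1 + constrB R p E *m z k.+1)
      - constrB R p E *m (z k.+1 - z k).
  by rewrite mulmxBr opprB [RHS]addrA [RHS]addrAC addrK.
rewrite [in RHS]scalemxAr scalerBr lE ![in RHS]mulmxBr [RHS]addrA.
set b := _ *m col_mx (alpha k) _.
rewrite (addrC b) subrK -[beta _]opprK -dqm_alpha_beta constrA_tr_mul_opp {}/b.
congr (_ + _); rewrite -mulmxBr -[in RHS]scalemxAr -scalerN; congr (_ *: _).
rewrite constrB_mul constrA_tr_mul !mulmxN opprD !opprK -mulmxDl.
by rewrite -linearD.
Qed.

End DQM.

(** * Instantiation of the energy estimate along the iterates *)

Theorem theorem1 (R : realType) (n p : nat) (E : {set 'I_n * 'I_n})
  (fi : 'I_n -> 'cV[R]_p -> R) (c m M L gu Gu go mu mu' : R)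
  (x : nat -> nodevec R n p) (z alpha beta : nat -> edgevec R p E)
  (xs : nodevec R n p) (zs alphas : edgevec R p E) (eta : nat -> R) :
  let f := total_cost fi in
  let Eo := oriented_inc R p E in
  let Eu := unoriented_inc R p E in
  let zeta k := Num.min (L / 2 * enorm (x k.+1 - x k)) (2 * M) in
  let u k := col_mx (z k) (alpha k) in
  let us := col_mx zs alphas in
  let delta k := Num.min
    ((mu - 1) * (c * gu ^+ 2 - eta k * zeta k) * go ^+ 2
      / (mu * mu' * (c * Gu ^+ 2 * gu ^+ 2
                     + 4 * zeta k ^+ 2 / (c * (mu' - 1)))))
    ((m - zeta k / eta k)
      / (c * Gu ^+ 2 / 4 + mu * M ^+ 2 / (c * go ^+ 2))) in
  symmetric_edges E -> connected_network E ->
  0 < c ->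
  is_solution f xs zs ->
  in_colspace Eo alphas ->
  grad f xs + (constrA R p E)^T *m col_mx alphas (- alphas) = 0 ->
  dqm_recursion f c x z alpha beta ->
  alpha 0%N = - beta 0%N ->
  Eu *m x 0%N = 2 *: z 0%N ->
  in_colspace Eo (alpha 0%N) ->
  0 < gu ->
  (forall s, singular_value Eu s -> gu <= s <= Gu) ->
  0 < go -> singular_value Eo go ->
  (forall s, singular_value Eo s -> s != 0 -> go <= s) ->
  0 < m -> m <= M ->
  (forall i, twice_differentiable (fi i)) ->
  (forall i y, loewner_le m%:M (hess (fi i) y)
               /\ loewner_le (hess (fi i) y) M%:M) ->
  (forall i y y', spectral_norm (hess (fi i) y - hess (fi i) y')
                    <= L * enorm (y - y')) ->
  4 * M ^+ 2 / (m * gu ^+ 2) < c ->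
  1 < mu -> 1 < mu' ->
  (forall k, zeta k / m < eta k
             /\ (zeta k != 0 -> eta k < c * gu ^+ 2 / zeta k)) ->
  forall k,
    0 < delta k
    /\ quad (energy_mx p E c) (u k.+1 - us)
         <= 1 / (1 + delta k) * quad (energy_mx p E c) (u k - us).

Proof.
move=> f Eo Eu zeta u us delta _ _ c0 [feas _] alphas_in opt dqm ab0 Eux0 a0_in.
move=> gu0 Eu_sv go0 go_sv Eo_sv m0 mM dfi hb hl _ mu1 mu'1 eta_bounds k.
have Eu_ge := singular_value_lower (ltW gu0) (fun s h => proj1 (andP (Eu_sv s h))).
have Eu_le := singular_value_upper (fun s h => proj2 (andP (Eu_sv s h))).
(* The singular value [go] supplies a nonzero vector on which the two bounds for [Eu] can be
   compared. *)
have Gu2 : 0 < Gu ^+ 2.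
  have [_ /eigenvalueP[v _ v0]] := go_sv.
  have v'0 : 0 < dot v^T v^T by rewrite dot_gt0// trmx_eq0.
  have := le_trans (Eu_ge v^T) (Eu_le v^T); rewrite ler_pM2r//.
  by apply: lt_le_trans; exact: exprn_gt0.
(* Feasibility makes both the source and the destination image of [xs] equal to [zs]. *)
have [Eoxs Euxs] : Eo *m xs = 0 /\ Eu *m xs = 2 *: zs.
  move/eqP: feas; rewrite constrA_mul constrB_mul add_col_mx col_mx_eq0 !subr_eq0.
  move=> /andP[/eqP As /eqP Ad]; split; first by rewrite mulmxBl As Ad subrr.
  by rewrite mulmxDl As Ad scaler_nat mulr2n.
have Eo_ge := nonzero_singular_value_lower (ltW go0) Eo_sv.
have Eu_x j : Eu *m x j = 2 *: z j := dqm_Eu_x c0 dqm ab0 Eux0 j.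
have a_in := dqm_alpha_colspace c0 dqm ab0 Eux0 _ a0_in.
have M0 : 0 < M := lt_le_trans m0 mM.
have zeta0 : 0 <= zeta k.
  rewrite le_min (mulrAC L); apply/andP; split; last by rewrite mulr_ge0// ltW.
  by apply: mulr_ge0 (total_lip_ge0 hl _) _; rewrite invr_ge0.
have [eta_gt eta_lt] := eta_bounds k.
split; first exact: rate_gt0.
have dzE : z k - zs = (z k.+1 - zs) - (z k.+1 - z k) by rewrite opprB [RHS]addrC subrKA.
have daE : alpha k - alphas = (alpha k.+1 - alphas) - (alpha k.+1 - alpha k).
  by rewrite opprB [RHS]addrC subrKA.
rewrite !opp_col_mx !add_col_mx !quad_energy_mx dzE daE.
apply: (energy_contraction c0 m0 mM gu0 go0 Gu2 mu1 mu'1 zeta0 eta_gt eta_lt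
  (dx := x k.+1 - xs) (d := x k.+1 - x k) (gF := grad f (x k.+1) - grad f xs)
  (e := grad_error fi (x k) (x k.+1)) (Eo := Eo) (Eu := Eu)).
- have st := dqm_stationarity dqm ab0 k.
  rewrite constrA_tr_mul_opp -/Eo in opt.
  (* The perturbed system is the stationarity of the iterate minus the optimality condition, so 0 is
     split as [0 - 0]. *)
  rewrite -[RHS]subr0 -[X in _ = _ - X]opt -[X in _ = X - _]st mulmxBr /grad_error.
  move: (grad f xs) (grad f (x k.+1)) (grad f (x k)) (hess f _ *m _) => a1 a2 a3 a4.
  move: (Eo^T *m alpha k.+1) (Eo^T *m alphas) (c *: _) => a5 a6 a7.
  by apply/colP => i; rewrite !mxE; ring.
- by rewrite mulmxBr Eoxs subr0; exact: dqm_alpha_step.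
- by rewrite mulmxBr Euxs Eu_x -scalerBr.
- by rewrite mulmxBr (Eu_x k.+1) (Eu_x k) -scalerBr.
- exact: (total_grad_monotone dfi hb).
- exact: (total_grad_lipschitz dfi m0 mM hb).
- exact: (enorm_grad_error dfi m0 mM hb hl).
- exact: Eu_ge.
- exact: Eu_le.
- apply: Eo_ge; have [w1 ->] := a_in k.+1; have [w2 ->] := alphas_in.
  by exists (w1 - w2); rewrite mulmxBr.
Qed.
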